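(* Let $n\ge 1$ be an integer and let $a,b,c\in\mathbb{R}$ with $ac>0$. Put $s=\sqrt{ac}$, $q=s/c$, $A_n=A_n(a,b,c)$ and $x=b/(2s)$. If $U_n(x)\ne 0$, then $A_n$ is invertible, and for $1\le i\le j\le n$ one has $$(A_n^{-1})_{ij}=\frac{(-1)^{i+j}}{s}\,q^{\,i-j}\,\frac{U_{i-1}(x)\,U_{n-j}(x)}{U_n(x)}.$$ For $1\le j\le i\le n$ one also has the equivalent formula $$(A_n^{-1})_{ij}=\frac{(-1)^{i+j}}{s}\,q^{\,i-j}\,\frac{U_{j-1}(x)\,U_{n-i}(x)}{U_n(x)}.$$ Equivalently, the inverse satisfies the weighted symmetry relation $$(A_n^{-1})_{ij}=q^{2(i-j)}(A_n^{-1})_{ji}\qquad (1\le i,j\le n).$$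
   Context: For $n\ge 1$ and $a,b,c\in\mathbb{R}$, $A_n(a,b,c)$ denotes the $n\times n$ tridiagonal Toeplitz matrix with all diagonal entries equal to $b$, all subdiagonal entries (positions $(i+1,i)$) equal to $a$, all superdiagonal entries (positions $(i,i+1)$) equal to $c$, and all other entries $0$. $U_m$ denotes the Chebyshev polynomial of the second kind: $U_0(x)=1$, $U_1(x)=2x$, $U_{m+1}(x)=2x\,U_m(x)-U_{m-1}(x)$. *)

(* Defs.v *)
From HB Require Import structures.
From mathcomp Require Import all_boot all_order all_algebra.
From mathcomp Require Import reals.

Set Implicit Arguments.
Unset Strict Implicit.
Unset Printing Implicit Defensive.

Import Order.TTheory GRing.Theory Num.Theory.
Local Open Scope ring_scope.

Definition tridiag_toeplitz (R : nzRingType) (n : nat) (a b c : R) : 'M[R]_n :=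
  \matrix_(i < n, j < n)
    if i == j then b
    else if (i == j.+1 :> nat) then a
    else if (j == i.+1 :> nat) then c
    else 0.

Fixpoint chebyshevU (R : nzRingType) (m : nat) : {poly R} :=
  match m with
  | 0 => 1
  | 1 => 2%:R *: 'X
  | (m''.+1 as m').+1 =>
      2%:R *: 'X * chebyshevU R m' - chebyshevU R m''
  end.

(* Main.v *)
Require Import Defs.
From HB Require Import structures.
From mathcomp Require Import all_boot all_order all_algebra.
From mathcomp Require Import reals.
From mathcomp Require Import zify ring.

Set Implicit Arguments.
Unset Strict Implicit.
Unset Printing Implicit Defensive.

Import Order.TTheory GRing.Theory Num.Theory.
Local Open Scope ring_scope.

(** Write [a = s q], [b = 2 s x], [c = s / q].  Conjugating by the diagonal matrix
    of the powers of [q] turns the matrix into [s] times the symmetric matrix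
    with diagonal [2 x] and off-diagonal entries [1], and the signs
    [(-1)^(i+j)] turn those off-diagonal entries into [-1].  The remaining
    matrix is the second-difference operator [- f (p-1) + 2 x f p - f (p+1)]
    on [1..n] with the boundary conditions [f 0 = f (n+1) = 0], and its inverse
    is a discrete Green function.

    The Chebyshev polynomials supply this Green function.  With [V p] standing
    for [U_(p-1) (x)], so that [V 0 = 0], the sequences [V p] and [V (n+1-p)]
    both solve the homogeneous recurrence, the first vanishing at the left end
    and the second at the right end.  Gluing them at [p = j] gives a kernel that
    the operator kills away from [p = j] ([green_recurrence]); at [p = j] the
    operator returns the Wronskian of the two solutions, which the addition
    formula [shiftU_addition] evaluates to [V (n+1) = U_n (x)].  Dividing by this
    nonzero number yields a right inverse, hence the inverse
    ([mulmx_tridiag_green]). *)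

(** * Chebyshev values with a shifted index *)

Section ShiftedChebyshev.
Variables (F : fieldType) (x : F).

(** The value of [U_(p-1)], extended by [U_(-1) = 0] so that the left boundary
    condition becomes an ordinary value of the sequence. *)
Definition shiftU (p : nat) : F :=
  if p is m.+1 then (chebyshevU F m).[x] else 0.

Lemma shiftU1 : shiftU 1 = 1.
Proof. by rewrite /= hornerC. Qed.

Lemma shiftUSS p : shiftU p.+2 = 2%:R * x * shiftU p.+1 - shiftU p.
Proof.
by case: p => [|p] /=; rewrite !hornerE // subr0.
Qed.

(** Both sides satisfy the same second-order recurrence in [k] and agree at
    [k = 0, 1]. *)
Lemma shiftU_addition m k :
  shiftU m.+1 * shiftU k.+1 - shiftU m * shiftU k = shiftU (m + k).+1.
Proof.
suff: shiftU m.+1 * shiftU k.+1 - shiftU m * shiftU k = shiftU (m + k).+1 /\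
      shiftU m.+1 * shiftU k.+2 - shiftU m * shiftU k.+1 = shiftU (m + k).+2.
  by case.
elim: k => [|k [IH0 IH1]].
  rewrite !addn0 !shiftUSS shiftU1 /=.
  by split; ring.
rewrite addnS; split=> //.
by rewrite (shiftUSS k.+1) (shiftUSS (m + k).+1) -IH1 -IH0 (shiftUSS k); ring.
Qed.

(** * The discrete Green function *)

(** The left solution up to the pole [J], the right solution beyond it, each
    scaled to agree at [J]. *)
Definition green (n p J : nat) : F :=
  if (p <= J)%N then shiftU p * shiftU (n.+1 - J)
  else shiftU J * shiftU (n.+1 - p).

Lemma green_leE n p J :
  (p <= J)%N -> green n p J = shiftU p * shiftU (n.+1 - J).
Proof. by rewrite /green => ->. Qed.

Lemma green_geE n p J :
  (J <= p)%N -> green n p J = shiftU J * shiftU (n.+1 - p).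
Proof.
rewrite /green leq_eqVlt => /predU1P[<-|ltJp]; first by rewrite leqnn.
by rewrite leqNgt ltJp.
Qed.

Lemma green_recurrence n p J : (p < n)%N -> (J <= n)%N ->
  - green n p J + 2%:R * x * green n p.+1 J - green n p.+2 J
    = (p.+1 == J)%:R * shiftU n.+1.
Proof.
move=> ltpn leJn; case: (ltngtP p.+1 J) => [ltpJ|ltJp|eqpJ].
- by rewrite !green_leE; [rewrite shiftUSS mulr0n mul0r; ring | lia ..].
- have [m defm] : exists m, n = (p + m.+1)%N by exists (n - p.+1)%N; lia.
  rewrite !green_geE; [|lia ..].
  have -> : (n.+1 - p = m.+2)%N by lia.
  have -> : (n.+1 - p.+1 = m.+1)%N by lia.
  have -> : (n.+1 - p.+2 = m)%N by lia.
  by rewrite shiftUSS mulr0n mul0r; ring.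
have [m defm] : exists m, n = (p.+1 + m)%N by exists (n - p.+1)%N; lia.
rewrite -eqpJ mulr1n mul1r (green_geE n (leqnSn p.+1)).
rewrite (green_leE n (leqnSn p)) (green_leE n (leqnn p.+1)).
have -> : (n.+1 - p.+1 = m.+1)%N by lia.
have -> : (n.+1 - p.+2 = m)%N by lia.
(* after one use of the recurrence at [p.+2], what remains is the Wronskian
   that the addition formula evaluates *)
by rewrite defm -shiftU_addition shiftUSS; ring.
Qed.

(** * Inverting the tridiagonal matrix *)

Lemma sum_shifted_delta n m (f : nat -> F) :
  f 0%N = 0 -> f n.+1 = 0 -> (m <= n.+1)%N ->
  \sum_(k < n) (k.+1 == m)%:R * f k.+1 = f m.
Proof.
move=> f0 fn lemn.
have vanish : ~~ (0 < m <= n)%N -> f m = 0.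
  by move=> ?; have [->|->] : m = 0%N \/ m = n.+1 by lia.
have [mn|mNn] := boolP (0 < m <= n)%N; last first.
  rewrite vanish // big1 // => k _.
  by case: eqP => [km|_]; [have := ltn_ord k; lia | rewrite mul0r].
have ltm : (m.-1 < n)%N by lia.
rewrite (bigD1 (Ordinal ltm)) //= prednK; last by case/andP: mn.
rewrite eqxx mul1r big1 ?addr0 // => k neqk.
case: eqP => [km|_]; last by rewrite mul0r.
by case/eqP: neqk; apply: val_inj; rewrite /= -km.
Qed.

(** The boundary values let the first and last rows have the same three-term
    form as the interior ones. *)
Lemma sum_tridiag_toeplitz n (a b c : F) (f : nat -> F) (i : 'I_n) :
  f 0%N = 0 -> f n.+1 = 0 ->
  \sum_(k < n) tridiag_toeplitz n a b c i k * f k.+1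
    = a * f i + b * f i.+1 + c * f i.+2.
Proof.
move=> f0 fn; have ltin := ltn_ord i.
rewrite -(sum_shifted_delta (m := i) f0 fn); last by lia.
rewrite -(sum_shifted_delta (m := i.+1) f0 fn); last by lia.
rewrite -(sum_shifted_delta (m := i.+2) f0 fn) //.
rewrite !mulr_sumr -!big_split /=; apply: eq_bigr => k _.
rewrite mxE !eqSS -val_eqE /= (eq_sym (k.+1)) (eq_sym (nat_of_ord k) i).
have [ik|neik] := eqVneq (nat_of_ord i) k.
  have -> : (nat_of_ord i == k.+1) = false by lia.
  have -> : (nat_of_ord k == i.+1) = false by lia.
  by rewrite /=; ring.
have [ik1|neik1] := eqVneq (nat_of_ord i) k.+1.
  have -> : (nat_of_ord k == i.+1) = false by lia.
  by rewrite /=; ring.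
by case: (nat_of_ord k == i.+1); rewrite /=; ring.
Qed.

(** With [r = - q], the ratio [r^i / r^j] is [(-1)^(i+j) q^(i-j)]: a single
    diagonal conjugation absorbs both the signs and the weights. *)
Definition green_mx n (s r : F) : 'M[F]_n :=
  \matrix_(i, j) (r ^+ i / r ^+ j * (green n i.+1 j.+1 / (s * shiftU n.+1))).

Lemma mulmx_tridiag_green n (s r : F) : s != 0 -> r != 0 -> shiftU n.+1 != 0 ->
  tridiag_toeplitz n (- (s * r)) (2%:R * s * x) (- (s / r)) *m green_mx n s r
    = 1%:M.
Proof.
move=> s0 r0 U0; apply/matrixP => i j; rewrite !mxE.
(* the column of index j, with its two boundary values; the factor r ^- j.+1
   instead of r ^- j compensates the shift of p *)
pose f p := r ^+ p / r ^+ j.+1 * (green n p j.+1 / (s * shiftU n.+1)).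
have f0 : f 0%N = 0 by rewrite /f /green /= !mul0r mulr0.
have fn : f n.+1 = 0.
  by rewrite /f (green_geE _ (leqW (ltn_ord j))) subnn mulr0 mul0r mulr0.
under eq_bigr => k _.
  rewrite [green_mx _ _ _ _ _]mxE.
  have -> : r ^+ k / r ^+ j = r ^+ k.+1 / r ^+ j.+1.
    by rewrite !exprS invfM mulrACA divff // mul1r.
  rewrite -/(f k.+1); over.
rewrite sum_tridiag_toeplitz // /f.
have rj0 : r ^+ j.+1 != 0 by rewrite expf_neq0.
transitivity (r ^+ i.+1 / r ^+ j.+1 / shiftU n.+1 *
  (- green n i j.+1 + 2%:R * x * green n i.+1 j.+1 - green n i.+2 j.+1)).
  move: (shiftU n.+1) U0 (green n i j.+1) (green n i.+1 j.+1) (green n i.+2 j.+1).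
  move: (r ^+ j.+1) rj0 => rj rj0 u u0 g0 g1 g2; rewrite !exprS.
  by field; rewrite s0 r0 u0 rj0.
rewrite green_recurrence // eqSS -val_eqE /=.
case: eqP => [->|_] /=; last by rewrite mul0r mulr0.
by rewrite divff // !mul1r mulVf.
Qed.

End ShiftedChebyshev.

Lemma invmx_uniq (F : fieldType) n (A B : 'M[F]_n) :
  A *m B = 1%:M -> A \in unitmx /\ invmx A = B.
Proof.
move=> AB1; have [uA _] := mulmx1_unit AB1; split=> //.
by rewrite -[LHS]mulmx1 -AB1 mulKmx.
Qed.

Lemma oppr_expf_div (F : fieldType) (q : F) (i j : nat) : q != 0 ->
  (- q) ^+ i / (- q) ^+ j = (-1) ^+ (i + j) * q ^ (i%:Z - j%:Z).
Proof.
move=> q0; rewrite expfzDr // -exprnN -exprnP !(exprNn q) invfM invr_sign exprD.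
by rewrite mulrACA.
Qed.

(* Indices i, j : 'I_n start at 0, so i and j below stand for the 1-based
   indices i.+1 and j.+1: U_{i-1} becomes U_i, U_{n-j} becomes
   U_{n - j.+1}, and (-1)^{i+j}, q^{i-j} are unaffected by the shift.
   The exponents of q are differences in int. *)
Theorem theorem4p1 (R : realType) (n : nat) (a b c : R)
    (hn : (1 <= n)%N) (hac : 0 < a * c) :
  let s := Num.sqrt (a * c) in
  let q := s / c in
  let A := tridiag_toeplitz n a b c in
  let x := b / (2%:R * s) in
  let U := fun m : nat => (chebyshevU R m).[x] in
  U n != 0 ->
  [/\ A \in unitmx,
      forall i j : 'I_n, (i <= j)%N ->
        invmx A i j = (-1) ^+ (i + j) / s * q ^ (i%:Z - j%:Z)
                      * (U i * U (n - j.+1)%N / U n),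
      forall i j : 'I_n, (j <= i)%N ->
        invmx A i j = (-1) ^+ (i + j) / s * q ^ (i%:Z - j%:Z)
                      * (U j * U (n - i.+1)%N / U n)
    & forall i j : 'I_n,
        invmx A i j = q ^ (2 * (i%:Z - j%:Z)) * invmx A j i].
Proof.
move=> s q A x U Un0.
have s_gt0 : 0 < s by rewrite sqrtr_gt0.
have s0 : s != 0 by rewrite gt_eqF.
have ss : s * s = a * c by rewrite -expr2 sqr_sqrtr // ltW.
have c0 : c != 0 by apply: contraTneq hac => ->; rewrite mulr0 ltxx.
have q0 : q != 0 by rewrite mulf_neq0 ?invr_eq0.
have defA : A = tridiag_toeplitz n (- (s * - q)) (2%:R * s * x) (- (s / - q)).
  rewrite /A; congr (tridiag_toeplitz n _ _ _).
  - by rewrite mulrN opprK /q mulrA ss mulfK.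
  - by rewrite /x; field.
  - by rewrite invrN mulrN opprK /q; field; rewrite c0 s0.
have [uA defG] : A \in unitmx /\ invmx A = green_mx x n s (- q).
  apply: invmx_uniq; rewrite defA mulmx_tridiag_green ?oppr_eq0 //.
have defU m : U m = shiftU x m.+1 by [].
have upper (i j : 'I_n) : (i <= j)%N ->
    invmx A i j = (-1) ^+ (i + j) / s * q ^ (i%:Z - j%:Z)
                  * (U i * U (n - j.+1)%N / U n).
  move=> leij; rewrite defG mxE green_leE // oppr_expf_div //.
  rewrite subSn // -!defU; field.
  by rewrite s0 Un0.
have lower (i j : 'I_n) : (j <= i)%N ->
    invmx A i j = (-1) ^+ (i + j) / s * q ^ (i%:Z - j%:Z)
                  * (U j * U (n - i.+1)%N / U n).
  move=> leji; rewrite defG mxE green_geE // oppr_expf_div //.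
  rewrite subSn // -!defU; field.
  by rewrite s0 Un0.
(* both formulas have the same Chebyshev factor after exchanging i and j, so
   only the powers of q differ *)
have weight (i j : nat) :
    q ^ (2 * (i%:Z - j%:Z)) * q ^ (j%:Z - i%:Z) = q ^ (i%:Z - j%:Z).
  by rewrite -expfzDr //; congr (q ^ _); ring.
split=> // i j; have [leij|/ltnW leji] := leqP i j.
  by rewrite upper // (lower j i) // addnC -(weight i j); ring.
by rewrite lower // (upper j i) // addnC -(weight i j); ring.
Qed.
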